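(* For a group $G$, the following are equivalent: 1. $Z(G)$ contains an element of order $2$. 2. There is a nonassociative extra loop $Q$ with $G = N(Q)$. 3. There is a nonassociative extra loop $Q$ with $G = N(Q)$, $|Q : G| = 8$, and $Z(Q) = Z(G)$.
   Context: A loop is a set with a binary operation having a two-sided identity $1$ and such that for all $a,b$ the equations $ax=b$ and $ya=b$ have unique solutions. In products, juxtaposition binds more tightly than $\cdot$. An extra loop is a loop that is both conjugacy closed and Moufang; equivalently (and this may be taken as the definition) a loop satisfying the identity $(xy\cdot z)\cdot x = x\cdot(y\cdot zx)$. The nucleus $N(Q)$ is the set of elements that associate with all pairs of elements of $Q$ in every position; it is a group, and in an extra loop it is a normal subloop, with $|Q:N(Q)|=|Q/N(Q)|$. The center $Z(Q)$ of a loop is the set of elements of $N(Q)$ that commute with every element of $Q$ (for a group, the usual center). *)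

(* Defs.v *)
From HB Require Import structures.
From mathcomp Require Import all_boot.
From mathcomp Require Import boolp classical_sets functions cardinality.

Set Implicit Arguments.
Unset Strict Implicit.
Unset Printing Implicit Defensive.

Local Open Scope classical_set_scope.
Local Open Scope group_scope.

HB.mixin Record UMagma_isLoop Q of UMagma Q := {
  loop_ldiv : forall a b : Q, exists! x : Q, a * x = b ;
  loop_rdiv : forall a b : Q, exists! y : Q, y * a = b
}.

#[short(type="loopType")]
HB.structure Definition Loop := {Q of UMagma_isLoop Q & UMagma Q}.

Definition extra_loop (Q : loopType) : Prop :=
  forall x y z : Q, ((x * y) * z) * x = x * (y * (z * x)).

Definition nucleus (Q : magmaType) : set Q :=
  [set a | forall x y : Q,
    [/\ a * (x * y) = (a * x) * y,
        x * (a * y) = (x * a) * y &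
        x * (y * a) = (x * y) * a]].

Definition center (Q : magmaType) : set Q :=
  [set a | nucleus a /\ forall x : Q, commute a x].

Arguments nucleus Q : clear implicits.
Arguments center Q : clear implicits.

(* Associativity makes the nucleus condition vacuous in a group. *)
Lemma center_groupE (G : groupType) :
  center G = [set a | forall x : G, commute a x].
Proof.
apply/seteqP; split=> [a [] //|a ca]; split=> // x y.
by split; rewrite mulgA.
Qed.

Definition has_order (G : groupType) (x : G) (n : nat) : Prop :=
  [/\ (0 < n)%N, x ^+ n = 1 & forall m : nat, (0 < m < n)%N -> x ^+ m <> 1].

Definition lcosets_of (Q : magmaType) (H : set Q) : set (set Q) :=
  [set [set x * h | h in H] | x in [set: Q]].

(* Intended for H the nucleus (or a normal subloop): for a general subloop
   the left cosets need not partition the loop. *)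
Definition has_index (Q : magmaType) (H : set Q) (n : nat) : Prop :=
  (lcosets_of H #= `I_n)%card.

(* "G = N(Q)" for an abstract group G: the map i identifies G with N(Q). *)
Definition nucleus_identification (G : groupType) (Q : loopType) (i : G -> Q)
    : Prop :=
  [/\ injective i, {morph i : x y / x * y} & range i = nucleus Q].

(* Main.v *)
Require Import Defs.
From HB Require Import structures.
From mathcomp Require Import all_boot.
From mathcomp Require Import boolp classical_sets functions cardinality.

(** An involution [z] in the center of [G] can serve as the associator of an extra
    loop.  Give the set of pairs [(g, u)], with [g] in [G] and [u] in the
    elementary abelian group [V] of order 8, the product
    [(g, u) (h, v) = (g h z^f(u,v), u + v)] for a cubic form [f] on [V] whose
    coboundary is the determinant.  Then triples associate up to
    [z^det(u,v,w)].  The determinant is alternating and trilinear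
    over the field with two elements, so the extra identity holds
    ([cube_ext_extra]); it is nondegenerate, so the nucleus is exactly [G]
    ([cube_ext_nucleus]).

    Conversely, an associator [c] different from 1 in an extra loop lies in the
    nucleus [N], commutes with [N] and squares to 1 ([extra_central_involution]).
    An extra loop is Moufang and conjugacy closed, and its squares are nuclear
    ([nucleus_square]).  Conjugacy closedness makes [N] normal ([nucleus_conj]) and
    makes the left inner mappings [L_(xy)^-1 L_x L_y] automorphisms
    ([inner_morph]).  The quotient [Q / N] is then a Moufang loop of exponent 2,
    hence an abelian group ([nuc_congC], [nuc_congA]), so associators are nuclear.
    The inner mapping of [x] and [y] sends [z] to [z c] with [c] the associator of
    [x], [y], [z], while it fixes [x], [y] and all of [N]; being an
    automorphism, this forces [c] to commute with [x], [y] and [N]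
    ([assoc_commute_nucleus], [assoc_commute_fixed]).  As it also fixes [z z],
    conjugation by [z] inverts [c] ([assoc_mulzc]).  The symmetry of associators
    under reversal ([assoc_rev]) shows that [c] commutes with [z] too, so
    [c = c^-1]. *)

Set Implicit Arguments.
Unset Strict Implicit.
Unset Printing Implicit Defensive.

Local Open Scope classical_set_scope.
Local Open Scope group_scope.

(** * Cancellation and right inverses in loops *)

Section LoopTheory.
Variable Q : loopType.
Implicit Types a x y : Q.

Lemma loop_mulI a : injective (mul a).
Proof.
move=> x y xy; have [z [_ zu]] := loop_ldiv a (a * y).
by rewrite -(zu x xy) (zu y).
Qed.

Lemma loop_mulIl a : injective (mul^~ a).
Proof.
move=> x y xy; have [z [_ zu]] := loop_rdiv a (y * a).
by rewrite -(zu x xy) (zu y).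
Qed.

Definition loop_inv x : Q := sval (cid (loop_ldiv x 1)).

Lemma loop_mulxV x : x * loop_inv x = 1.
Proof. by rewrite /loop_inv; case: cid => y [/= ->]. Qed.

End LoopTheory.

(** * Extra loops have the inverse property and are Moufang *)

Section ExtraLoop.
Variable Q : loopType.
Hypothesis extraQ : extra_loop Q.
Implicit Types a m n p w x y z : Q.

Local Notation "x ^-1" := (loop_inv x) : group_scope.
Local Notation N := (nucleus Q).

(** The right inverse is at first one-sided.  The extra identity with [y] (here)
    or [z] ([loop_mulxVK]) equal to the inverse of [x] makes multiplication by
    [x^-1] undo multiplication by [x] on either side, which in turn makes
    inversion an involutive antiautomorphism.  So an equation [a * b = c] can be
    solved for [a] as [c * b^-1], the step that turns one autotopism into
    others below. *)
Lemma loop_mulVKx x w : x * (x^-1 * w) = w.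
Proof.
have [z [<- _]] := loop_rdiv x w.
by rewrite -extraQ loop_mulxV mul1g.
Qed.

Lemma loop_mulKx x w : x^-1 * (x * w) = w.
Proof. by apply: (@loop_mulI _ x); rewrite loop_mulVKx. Qed.

Lemma loop_mulVx x : x^-1 * x = 1.
Proof. by rewrite -{2}[x]mulg1 loop_mulKx. Qed.

Lemma loop_mulxVK x w : (w * x^-1) * x = w.
Proof.
rewrite -[w](loop_mulVKx x).
by rewrite extraQ loop_mulVx mulg1.
Qed.

Lemma loop_mulxK x w : (w * x) * x^-1 = w.
Proof. by apply: (@loop_mulIl _ x); rewrite /= loop_mulxVK. Qed.

Lemma loop_invK x : x^-1^-1 = x.
Proof. by rewrite -[LHS]mul1g -(loop_mulxV x) loop_mulxK. Qed.

Lemma loop_invM x y : (x * y)^-1 = y^-1 * x^-1.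
Proof.
by rewrite -(loop_mulKx (x * y) y^-1) loop_mulxK loop_mulxK.
Qed.

Lemma flexible x y : (x * y) * x = x * (y * x).
Proof. by have := extraQ x y 1; rewrite mulg1 mul1g. Qed.

(** With [z = w x^-1] the extra identity says that
    [(L_x, R_x^-1, R_x^-1 L_x)] is an autotopism.  Solving this equation for one
    of the two factors on the left gives the two conjugacy-closed laws
    [left_cc] and [right_cc], the other autotopisms of the same family. *)
Lemma extra_autotopism x y w : (x * y) * (w * x^-1) = (x * (y * w)) * x^-1.
Proof. by rewrite -[LHS](loop_mulxK x) extraQ loop_mulxVK. Qed.

Definition loop_conj x y := (x * y) * x^-1.

Lemma left_cc x y z : x * (y * z) = loop_conj x y * (x * z).
Proof.
have := extra_autotopism x (y * z) z^-1; rewrite loop_mulxK -loop_invM.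
by rewrite /loop_conj => <-; rewrite loop_mulxVK.
Qed.

Lemma right_cc x y z : (y * z) * x = (y * x) * ((x^-1 * z) * x).
Proof.
have := extra_autotopism x^-1 y^-1 (y * z).
by rewrite loop_mulKx loop_invK -loop_invM => <-; rewrite loop_mulVKx.
Qed.

(** The autotopisms of [extra_autotopism] and [right_cc] compose to
    [(L_x R_x, L_x^-1, L_x)], which is the left Moufang law. *)
Lemma left_moufang x y z : ((x * y) * x) * (x^-1 * z) = x * (y * z).
Proof.
have := extra_autotopism x (y * x) ((x^-1 * z) * x).
by rewrite -right_cc -!flexible !loop_mulxK.
Qed.

Lemma middle_moufang x y z : (x * y) * (z * x) = (x * (y * z)) * x.
Proof.
have := left_moufang x (y * z) z^-1; rewrite loop_mulxK => <-.
by rewrite -loop_invM loop_mulxVK.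
Qed.

(** Comparing the middle Moufang autotopism [(L_x, R_x, L_x R_x)] with
    [(L_x, R_x^-1, R_x^-1 L_x)] leaves [(1, R_x R_x, R_x R_x)]: squares
    associate in the right position. *)
Lemma mul_square x y z : y * ((z * x) * x) = ((y * z) * x) * x.
Proof.
by apply: (@loop_mulI _ x); rewrite -extraQ middle_moufang !flexible.
Qed.

Lemma right_alternative x y : y * (x * x) = (y * x) * x.
Proof. by have := mul_square x y 1; rewrite mul1g mulg1. Qed.

(** * The nucleus and the quotient by it *)

(** By the inverse property an element that associates in one position associates
    in all three.  The middle position is the convenient pivot, as inverses
    visibly preserve it. *)
Lemma middle_nuclearV n :
  (forall x y, x * (n * y) = (x * n) * y) ->
  forall x y, x * (n^-1 * y) = (x * n^-1) * y.
Proof.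
move=> nM x y; apply: (can_inj loop_invK); rewrite !loop_invM loop_invK.
by rewrite nM.
Qed.

Lemma middle_left_nuclear n :
  (forall x y, x * (n * y) = (x * n) * y) ->
  forall x y, n^-1 * (x * y) = (n^-1 * x) * y.
Proof.
move=> nM x y.
have e := nM x^-1 (n^-1 * (x * y)).
rewrite loop_mulVKx loop_mulKx in e.
have -> : n^-1 * x = (x^-1 * n)^-1 by rewrite loop_invM loop_invK.
by rewrite [in RHS]e loop_mulKx.
Qed.

Lemma middle_nucleus n :
  (forall x y, x * (n * y) = (x * n) * y) -> N n.
Proof.
move=> nM x y; split=> //.
  by rewrite -[n]loop_invK; exact/middle_left_nuclear/middle_nuclearV.
apply: (can_inj loop_invK); rewrite !loop_invM; apply/esym.
exact: middle_left_nuclear.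
Qed.

Lemma right_nucleus n :
  (forall x y, x * (y * n) = (x * y) * n) -> N n.
Proof.
move=> nR; apply: middle_nucleus => x y.
have := nR (x * (n * y)) ((n * y)^-1).
rewrite loop_mulxK => <-.
by rewrite loop_invM loop_mulxVK loop_mulxVK.
Qed.

Lemma left_nucleus n :
  (forall x y, n * (x * y) = (n * x) * y) -> N n.
Proof.
move=> nL.
have nV : N n^-1.
  apply: right_nucleus => x y; apply: (can_inj loop_invK).
  by rewrite !loop_invM loop_invK nL.
rewrite -[n]loop_invK; apply: middle_nucleus.
by apply: middle_nuclearV => x y; have [] := nV x y.
Qed.

Lemma nucleus_square x : N (x * x).
Proof. by apply: right_nucleus => y z; rewrite !right_alternative mul_square. Qed.

Lemma nucleusV n : N n -> N n^-1.
Proof.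
move=> nN; apply/middle_nucleus/middle_nuclearV => x y.
by have [] := nN x y.
Qed.

(** Stated with the membership proof first, so that in a rewrite it selects which
    factor is the nuclear one. *)
Lemma nucAl n : N n -> forall x y, n * (x * y) = (n * x) * y.
Proof. by move=> nN x y; have [] := nN x y. Qed.
Lemma nucAm n : N n -> forall x y, x * (n * y) = (x * n) * y.
Proof. by move=> nN x y; have [] := nN x y. Qed.
Lemma nucAr n : N n -> forall x y, x * (y * n) = (x * y) * n.
Proof. by move=> nN x y; have [] := nN x y. Qed.

Lemma nucleusM m n : N m -> N n -> N (m * n).
Proof.
move=> mN nN; apply: middle_nucleus => x y.
by rewrite -(nucAl mN) !(nucAm mN) (nucAm nN).
Qed.

(** The autotopism [(L_n, 1, L_n)] of a nuclear [n], conjugated by the autotopism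
    [left_cc], again has trivial middle component; hence the nucleus is
    normal. *)
Lemma nucleus_conj x n : N n -> N (loop_conj x n).
Proof.
move=> nN; apply: left_nucleus => p q.
have tE s w : loop_conj x n * (loop_conj x s * w) = loop_conj x (n * s) * w.
  rewrite -[w](loop_mulVKx x) -!left_cc.
  by rewrite (nucAl nN).
have pE : p = loop_conj x (x^-1 * (p * x)).
  by rewrite /loop_conj loop_mulVKx loop_mulxK.
rewrite pE tE; congr (_ * q).
by have := tE (x^-1 * (p * x)) 1; rewrite !mulg1.
Qed.

(** Congruence modulo the nucleus, which stands in for the quotient loop [Q / N].
    Normality makes it compatible with products ([nuc_congM]), and the quotient
    turns out to be an abelian group of exponent 2. *)
Definition nuc_cong x y := N (x^-1 * y).

Lemma nuc_congMn x n : N n -> nuc_cong x (x * n).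
Proof. by rewrite /nuc_cong loop_mulKx. Qed.

Lemma nuc_congP x y : nuc_cong x y -> exists2 n, N n & y = x * n.
Proof. by move=> xy; exists (x^-1 * y) => //; rewrite loop_mulVKx. Qed.

Lemma nuc_cong_sym x y : nuc_cong x y -> nuc_cong y x.
Proof. by move=> /nucleusV; rewrite /nuc_cong loop_invM loop_invK. Qed.

Lemma nuc_cong_trans y x z : nuc_cong x y -> nuc_cong y z -> nuc_cong x z.
Proof.
move=> /nuc_congP[m mN ->] /nuc_congP[n nN ->].
by rewrite -(nucAr nN); exact/nuc_congMn/nucleusM.
Qed.

Lemma nucleus_swap n x : N n -> exists2 m, N m & n * x = x * m.
Proof.
move=> nN; exists (loop_conj x^-1 n); first exact: nucleus_conj.
by rewrite /loop_conj loop_invK -(nucAm nN) loop_mulVKx.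
Qed.

Lemma nuc_congM x x' y y' :
  nuc_cong x x' -> nuc_cong y y' -> nuc_cong (x * y) (x' * y').
Proof.
move=> /nuc_congP[m mN ->] /nuc_congP[n nN ->].
have [k kN kE] := nucleus_swap y mN.
rewrite -(nucAm mN) (nucAl mN) kE (nucAr nN) (nucAr kN) -(nucAr nN).
by exact/nuc_congMn/nucleusM.
Qed.

(** [x^-1 * x^-1] is a square: the quotient has exponent 2. *)
Lemma nuc_congV x : nuc_cong x x^-1.
Proof. exact: nucleus_square. Qed.

(** A loop with antiautomorphic inverses in which every element is its own inverse
    is commutative. *)
Lemma nuc_congC x y : nuc_cong (x * y) (y * x).
Proof.
apply: nuc_cong_trans (nuc_congV _) _; rewrite loop_invM.
by apply: nuc_congM; apply/nuc_cong_sym/nuc_congV.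
Qed.

(** In a commutative Moufang loop of exponent 2 the left Moufang law
    [((b a) b) (b^-1 c) = b (a c)] reduces to [a (b c) = b (a c)], which together
    with commutativity is associativity. *)
Lemma nuc_congA x y z : nuc_cong ((x * y) * z) (x * (y * z)).
Proof.
have refl w : nuc_cong w w.
  by rewrite /nuc_cong loop_mulVx; apply: right_nucleus => p q; rewrite !mulg1.
have swap a b c : nuc_cong (b * (a * c)) (a * (b * c)).
  rewrite -left_moufang; apply: nuc_congM; last first.
    exact: nuc_congM (nuc_cong_sym (nuc_congV b)) _.
  apply: nuc_cong_trans (nuc_congM (nuc_congC b a) (refl b)) _.
  by rewrite -right_alternative; exact/nuc_cong_sym/nuc_congMn/nucleus_square.
apply: nuc_cong_trans (nuc_congC _ _) _.
apply: nuc_cong_trans (swap _ _ _) _.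
apply: nuc_congM (refl x) _; exact: nuc_congC.
Qed.

(** * Associators are central involutions of the nucleus *)

(** The left inner mapping [L_(xy)^-1 L_x L_y].  It moves each [z] by an associator
    ([innerE]), so statements about associators are read off from the fact that
    it is an automorphism. *)
Definition inner x y z := (x * y)^-1 * (x * (y * z)).

(** Three applications of [left_cc] write the left inner mapping as the second and
    third component of an autotopism.  As it fixes 1, evaluation at [b = 1]
    identifies the first component with it as well. *)
Lemma inner_morph x y a b : inner x y (a * b) = inner x y a * inner x y b.
Proof.
set u := (x * y)^-1; set U := loop_conj u.
have E p q : inner x y (p * q) = U (loop_conj x (loop_conj y p)) * inner x y q.
  by rewrite /inner (left_cc y) (left_cc x) (left_cc u).
rewrite E; congr (_ * _); rewrite -[a in RHS]mulg1 E.
by rewrite /inner mulg1 loop_mulVx mulg1.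
Qed.

Lemma inner_nucleus x y n : N n -> inner x y n = n.
Proof. by move=> nN; rewrite /inner (nucAr nN) loop_mulKx. Qed.

Lemma inner_fixl x y : inner x y x = x.
Proof. by rewrite /inner -flexible loop_mulKx. Qed.

Lemma inner_fixr x y : inner x y y = y.
Proof. by rewrite /inner right_alternative loop_mulKx. Qed.

Definition associator x y z := ((x * y) * z)^-1 * (x * (y * z)).

(** This is associativity of the quotient by the nucleus. *)
Lemma assoc_nucleus x y z : N (associator x y z).
Proof. exact: nuc_congA. Qed.

Lemma assocE x y z : x * (y * z) = ((x * y) * z) * associator x y z.
Proof. by rewrite /associator loop_mulVKx. Qed.

Lemma innerE x y z : inner x y z = z * associator x y z.
Proof.
by rewrite /inner (assocE x y z) -(nucAr (assoc_nucleus x y z)) loop_mulKx.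
Qed.

(** For a nuclear [n] write [z n = m z] with [m] nuclear, and compute the inner
    mapping of both sides: as it fixes [n] and [m] and sends [z] to [z c], we get
    [z c n = m z c = z n c]. *)
Lemma assoc_commute_nucleus x y z n : N n -> commute (associator x y z) n.
Proof.
move=> nN; set c := associator x y z; have cN : N c by exact: assoc_nucleus.
have [m mN zn] : exists2 m, N m & z * n = m * z.
  exists (loop_conj z n); first exact: nucleus_conj.
  by rewrite /loop_conj loop_mulxVK.
have : inner x y (z * n) = inner x y (m * z) by rewrite zn.
rewrite !inner_morph (inner_nucleus _ _ nN) (inner_nucleus _ _ mN) !innerE -/c.
rewrite (nucAl mN) -zn -(nucAm cN) -(nucAm nN).
exact: loop_mulI.
Qed.

(** As [z w] and [w z] differ by a nuclear factor [m], the automorphism moves both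
    by the same associator [c]: [z c w = (w z c) m = w z m c = z w c]. *)
Lemma assoc_commute_fixed x y z w : inner x y w = w -> commute (associator x y z) w.
Proof.
move=> wE; set c := associator x y z; have cN : N c by exact: assoc_nucleus.
have /nuc_congP[m mN zw] := nuc_congC w z.
have : inner x y (z * w) = inner x y ((w * z) * m) by rewrite zw.
rewrite !inner_morph wE (inner_nucleus _ _ mN) !innerE -/c.
rewrite -(nucAm cN) (nucAr cN) -(nucAr mN) (assoc_commute_nucleus x y z mN).
rewrite (nucAm mN) -zw -(nucAr cN).
exact: loop_mulI.
Qed.

Lemma commute_invV x y : commute x y -> commute x^-1 y^-1.
Proof. by rewrite /commute -!loop_invM => ->. Qed.

(** The automorphism fixes the nuclear element [z z], so [(z c)(z c) = z z]:
    conjugation by [z] inverts the associator [c]. *)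
Lemma assoc_mulzc x y z : associator x y z * (z * associator x y z) = z.
Proof.
set c := associator x y z; have cN : N c by exact: assoc_nucleus.
have := inner_nucleus x y (nucleus_square z).
rewrite inner_morph innerE -/c -(nucAm cN); exact: loop_mulI.
Qed.

Lemma assoc_commutel x y z : commute (associator x y z) x.
Proof. exact/assoc_commute_fixed/inner_fixl. Qed.

Lemma assoc_commutem x y z : commute (associator x y z) y.
Proof. exact/assoc_commute_fixed/inner_fixr. Qed.

(** Inverting [x (y z) = ((x y) z) c] exhibits the associator of the inverses in
    reverse order as a conjugate of [c] by a product of [x^-1], [y^-1] and
    [z^-1]; the first two commute with [c] and the third inverts it. *)
Lemma assoc_rev x y z : associator z^-1 y^-1 x^-1 = (associator x y z)^-1.
Proof.
set c := associator x y z; have cN : N c by exact: assoc_nucleus.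
have dN := nucleusV cN.
set v := (z^-1 * y^-1) * x^-1.
have vE : z^-1 * (y^-1 * x^-1) = c * v.
  have := congr1 (@loop_inv Q) (assocE x y z).
  rewrite -/c (loop_invM _ c) (loop_invM x) (loop_invM y) (loop_invM _ z).
  by rewrite (loop_invM x) -/v => ->; rewrite loop_mulVKx.
have cz : c * z^-1 = z^-1 * c^-1.
  have e := assoc_mulzc x y z; rewrite -/c (nucAl cN) in e.
  have {}e : c * z = z * c^-1 by rewrite -[in RHS]e loop_mulxK.
  by rewrite -loop_invM e loop_invM loop_invK.
have dx : commute c^-1 x^-1 by exact/commute_invV/assoc_commutel.
have dy : commute c^-1 y^-1 by exact/commute_invV/assoc_commutem.
apply: (@loop_mulI _ v); rewrite -assocE vE /v.
by rewrite !(nucAl cN) cz -(nucAm dN) dy (nucAr dN) -(nucAm dN) dx (nucAr dN).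
Qed.

(** An associator commutes with its first two arguments, and reversal makes the
    third argument the first. *)
Lemma assoc_commuter x y z : commute (associator x y z) z.
Proof.
have /commute_invV := assoc_commutel z^-1 y^-1 x^-1.
by rewrite assoc_rev !loop_invK.
Qed.

(** Conjugation by [z] both inverts and fixes the associator. *)
Lemma assoc_square x y z : associator x y z * associator x y z = 1.
Proof.
set c := associator x y z; have cN : N c by exact: assoc_nucleus.
have := assoc_mulzc x y z; rewrite -/c (nucAl cN) (assoc_commuter x y z).
by rewrite -(nucAr cN) -[RHS]mulg1; exact: loop_mulI.
Qed.

Lemma extra_central_involution (x y z : Q) : x * (y * z) <> (x * y) * z ->
  exists c : Q, [/\ N c, c <> 1, c * c = 1 & forall n, N n -> commute c n].
Proof.
move=> xyz; exists (associator x y z); split=> //.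
- exact: assoc_nucleus.
- by move=> c1; apply: xyz; rewrite assocE c1 mulg1.
- exact: assoc_square.
- by move=> n; exact: assoc_commute_nucleus.
Qed.
End ExtraLoop.

(** * A twisting cochain on the elementary abelian group of order 8 *)

Definition F2cube := (bool * bool * bool)%type.
Definition cube_add (u v : F2cube) : F2cube :=
  (u.1.1 (+) v.1.1, u.1.2 (+) v.1.2, u.2 (+) v.2).
Definition cube0 : F2cube := (false, false, false).

(** The part of [(u + v)_1 (u + v)_2 (u + v)_3] of degree 2 in [u] and 1 in [v].
    Its coboundary [cube_assoc] is the permanent, that is, modulo 2, the
    determinant of the three arguments: a nondegenerate alternating trilinear
    form. *)
Definition cube_twist (u v : F2cube) : bool :=
  (u.1.1 && u.1.2 && v.2) (+) (u.1.1 && v.1.2 && u.2) (+) (v.1.1 && u.1.2 && u.2).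

Lemma cube_addK u : involutive (cube_add u).
Proof. by case: u => [[[] []] []] [[[] []] []]. Qed.

Lemma cube_addC : commutative cube_add.
Proof. by move=> [[[] []] []] [[[] []] []]. Qed.

Lemma cube_addKr u v : cube_add (cube_add v u) u = v.
Proof. by move: u v => [[[] []] []] [[[] []] []]. Qed.

Lemma cube_addA : associative cube_add.
Proof. by move=> [[[] []] []] [[[] []] []] [[[] []] []]. Qed.

Lemma cube_add0 : left_id cube0 cube_add.
Proof. by move=> [[[] []] []]. Qed.

Lemma cube_twist0l v : cube_twist cube0 v = false.
Proof. by move: v => [[[] []] []]. Qed.

Lemma cube_twist0r v : cube_twist v cube0 = false.
Proof. by move: v => [[[] []] []]. Qed.

Definition cube_assoc u v w :=
  cube_twist v w (+) cube_twist u (cube_add v w)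
  (+) cube_twist u v (+) cube_twist (cube_add u v) w.

(** The exponent of the extra identity.  Reassociating [((u v) w) u] first to
    [(u v) (w u)] and then to [u (v (w u))] costs
    [det (u + v, w, u) + det (u, v, w + u) = 2 det (u, v, w) = 0]. *)
Lemma cube_twist_extra u v w :
  cube_twist u v (+) cube_twist (cube_add u v) w
    (+) cube_twist (cube_add (cube_add u v) w) u =
  cube_twist w u (+) cube_twist v (cube_add w u)
    (+) cube_twist u (cube_add v (cube_add w u)).
Proof. by move: u v w => [[[] []] []] [[[] []] []] [[[] []] []]. Qed.

Lemma cube_assoc_nondegenerate u : u != cube0 -> exists v w, cube_assoc u v w.
Proof.
move=> u0; apply: contrapT => nvw; move/negP: u0; apply.
have e v w : cube_assoc u v w = false.
  by apply/negP => vw; apply: nvw; exists v, w.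
(* The determinants of [u] with two basis vectors are the coordinates of [u]. *)
move: (e (true, false, false) (false, true, false)).
move: (e (true, false, false) (false, false, true)).
move: (e (false, true, false) (false, false, true)).
by move: u {e nvw} => [[[] []] []].
Qed.

Lemma cube_assoc0 u v w : cube0 \in [:: u; v; w] -> cube_assoc u v w = false.
Proof. by move: u v w => [[[] []] []] [[[] []] []] [[[] []] []]. Qed.

Lemma card_cube : ([set: F2cube] #= `I_8)%card.
Proof.
have -> : 8 = #|{: F2cube}| by rewrite !card_prod card_bool.
rewrite (card_eqr card_II).
have <- : range (@enum_rank F2cube) = setT.
  by apply/seteqP; split=> // k _; exists (enum_val k) => //; exact: enum_valK.
by rewrite card_eq_sym; apply: inj_card_eq => u v _ _; exact: enum_rank_inj.
Qed.

(** * The extension of a group by the twisted cube *)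

(** Only the product depends on [z]; it is an argument of the type so that each [z]
    has its own loop structure. *)
Definition cube_ext (G : groupType) (z : G) : Type := (G * F2cube)%type.

Section CubeExtension.
Variables (G : groupType) (z : G).
Local Notation Q := (cube_ext z).

HB.instance Definition _ := Choice.on Q.

Definition cube_ext_mul (a b : Q) : Q :=
  (a.1 * b.1 * z ^+ cube_twist a.2 b.2, cube_add a.2 b.2).

HB.instance Definition _ := hasMul.Build Q cube_ext_mul.

Lemma cube_extM (a b : Q) :
  a * b = (a.1 * b.1 * z ^+ cube_twist a.2 b.2, cube_add a.2 b.2).
Proof. by []. Qed.

Lemma cube_ext_mul1 : left_id ((1, cube0) : Q) mul.
Proof. by case=> g u; rewrite cube_extM/= cube_twist0l cube_add0 mul1g mulg1. Qed.

Lemma cube_ext_1mul : right_id ((1, cube0) : Q) mul.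
Proof.
by case=> g u; rewrite cube_extM/= cube_twist0r cube_addC cube_add0 !mulg1.
Qed.

HB.instance Definition _ := Magma_isUMagma.Build Q cube_ext_mul1 cube_ext_1mul.

Lemma cube_ext_ldiv (a b : Q) : exists! x : Q, a * x = b.
Proof.
case: a b => [g u] [h w].
exists (g^-1 * (h * z ^- cube_twist u (cube_add u w)), cube_add u w).
split=> [|[k v]]; rewrite cube_extM/=.
  by rewrite cube_addK mulVKg mulgVK.
by case=> <- <-; rewrite cube_addK mulgK mulKg.
Qed.

Lemma cube_ext_rdiv (a b : Q) : exists! y : Q, y * a = b.
Proof.
case: a b => [g u] [h w].
exists (h * z ^- cube_twist (cube_add w u) u * g^-1, cube_add w u).
split=> [|[k v]]; rewrite cube_extM/=.
  by rewrite cube_addKr !mulgVK.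
by case=> <- <-; rewrite cube_addKr !mulgK.
Qed.

HB.instance Definition _ := UMagma_isLoop.Build Q cube_ext_ldiv cube_ext_rdiv.

Definition cube_ext_base (g : G) : Q := (g, cube0).

Lemma cube_ext_base_inj : injective cube_ext_base.
Proof. by move=> g h []. Qed.

Lemma cube_ext_baseM : {morph cube_ext_base : g h / g * h}.
Proof. by move=> g h; rewrite cube_extM /= mulg1. Qed.

Hypothesis zC : forall g, commute z g.
Hypothesis zz1 : z * z = 1.
Hypothesis z_neq1 : z <> 1.

Lemma expbD b c : z ^+ (b : bool) * z ^+ (c : bool) = z ^+ (b (+) c).
Proof. by case: b; case: c; rewrite ?zz1 ?mulg1 ?mul1g. Qed.

Lemma mulgAC_expb (b : bool) g h : g * z ^+ b * h = g * h * z ^+ b.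
Proof. by case: b; rewrite ?mulg1// -!mulgA [z * h]zC. Qed.

Lemma cube_ext_extra : extra_loop Q.
Proof.
move=> [g u] [h v] [k w]; rewrite !cube_extM/=; congr pair; last first.
  by rewrite -!cube_addA [cube_add w u]cube_addC.
rewrite !mulgA (mulgAC_expb _ _ k) !(mulgAC_expb _ _ g) -!mulgA !expbD addbA.
by rewrite cube_twist_extra addbA.
Qed.

Lemma cube_ext_index : has_index (range cube_ext_base) 8.
Proof.
pose fiber (u : F2cube) : set Q := [set a | a.2 = u].
have cosetE (a : Q) : [set a * h | h in range cube_ext_base] = fiber a.2.
  apply/seteqP; split=> [_ [_ [g _ <-] <-]|[h w] wE].
    by rewrite /fiber/= cube_addC cube_add0.
  have {w wE}-> : w = a.2 := wE.
  exists (cube_ext_base (a.1^-1 * h)); first by exists (a.1^-1 * h).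
  by rewrite cube_extM/= cube_twist0r mulg1 mulVKg cube_addC cube_add0.
have fiber_inj : injective fiber.
  by move=> u v /seteqP[/(_ (1, u) erefl)].
rewrite /has_index.
have -> : lcosets_of (range cube_ext_base) = range fiber.
  apply/seteqP; split=> _ [a _ <-]; first by exists a.2 => //; rewrite cosetE.
  by exists (1, a) => //; exact: cosetE.
apply: card_eq_trans card_cube; apply: inj_card_eq => u v _ _; exact: fiber_inj.
Qed.

Lemma cube_ext_assoc (a b c : Q) :
  (a * b) * c =
  ((a * (b * c)).1 * z ^+ cube_assoc a.2 b.2 c.2, (a * (b * c)).2).
Proof.
case: a b c => [g u] [h v] [k w]; rewrite !cube_extM/= cube_addA; congr pair.
rewrite !mulgA (mulgAC_expb _ _ k) -!mulgA !expbD; congr (_ * (_ * (_ * z ^+ _))).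
rewrite /cube_assoc.
move: (cube_twist v w) (cube_twist u (cube_add v w)).
by move: (cube_twist u v) (cube_twist (cube_add u v) w) => [] [] [] [].
Qed.

Lemma cube_ext_assocP (a b c : Q) :
  a * (b * c) = (a * b) * c <-> cube_assoc a.2 b.2 c.2 = false.
Proof.
rewrite cube_ext_assoc; case: (cube_assoc _ _ _); split=> //; last first.
  by rewrite mulg1 -surjective_pairing.
by move=> /(congr1 fst)/= /esym; rewrite -[RHS]mulg1 => /mulgI/z_neq1.
Qed.

Lemma cube_ext_nucleus : nucleus Q = range cube_ext_base.
Proof.
apply/seteqP; split=> [[g u] nu|_ [g _ <-] b c]; last first.
  by split; apply/cube_ext_assocP/cube_assoc0; rewrite !inE eqxx ?orbT.
have [->|/cube_assoc_nondegenerate[v [w uvw]]] := eqVneq u cube0; first by exists g.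
have [/cube_ext_assocP + _ _] := nu (1, v) (1, w).
by rewrite uvw.
Qed.

Lemma cube_ext_not_associative : ~ associative (@mul Q).
Proof.
move=> mulA; have : nucleus Q (1, (true, true, true)) by split; exact: mulA.
by rewrite cube_ext_nucleus => -[].
Qed.

Lemma cube_ext_center : cube_ext_base @` center G = center Q.
Proof.
rewrite center_groupE; apply/seteqP; split=> [_ [g gC <-]|a [+ aC]].
  split=> [|[h v]]; first by rewrite cube_ext_nucleus; exists g.
  by rewrite /commute !cube_extM cube_twist0l cube_twist0r/= cube_addC gC.
rewrite cube_ext_nucleus => -[g _ ga]; exists g => // h.
by apply: cube_ext_base_inj; rewrite !cube_ext_baseM ga; exact: aC.
Qed.
End CubeExtension.

Theorem proposition3p1 (G : groupType) :
  [<-> exists2 z : G, center G z & has_order z 2;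
       exists (Q : loopType) (i : G -> Q),
         [/\ extra_loop Q, ~ associative (@mul Q)
           & nucleus_identification i];
       exists (Q : loopType) (i : G -> Q),
         [/\ extra_loop Q, ~ associative (@mul Q),
             nucleus_identification i,
             has_index (range i) 8
           & i @` center G = center Q]].
Proof.
have ext3 : (exists2 z : G, center G z & has_order z 2) ->
  exists (Q : loopType) (i : G -> Q),
  [/\ extra_loop Q, ~ associative (@mul Q), nucleus_identification i,
      has_index (range i) 8 & i @` center G = center Q].
  case=> z [_ zC] [_ zz1 z_min].
  have z_neq1 : z <> 1 by exact: (z_min 1%N).
  exists (cube_ext z), (@cube_ext_base _ z); split.
  - exact: cube_ext_extra.
  - exact: cube_ext_not_associative.
  - split; [exact: cube_ext_base_inj|exact: cube_ext_baseM|].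
    by rewrite cube_ext_nucleus.
  - exact: cube_ext_index.
  - exact: cube_ext_center.
have ext1 : (exists (Q : loopType) (i : G -> Q),
    [/\ extra_loop Q, ~ associative (@mul Q) & nucleus_identification i]) ->
  exists2 z : G, center G z & has_order z 2.
  move=> [Q [i [extraQ nassoc [i_inj iM iN]]]].
  have [x [y [w xyw]]] : exists x y w : Q, x * (y * w) <> (x * y) * w.
    apply: contrapT => all_assoc; apply: nassoc => x y w; apply: contrapT => xyw.
    by apply: all_assoc; exists x, y, w.
  have [c [cN c1 c2 cC]] := extra_central_involution extraQ xyw.
  have i1 : i 1 = 1.
    by apply: (@loop_mulI _ (i 1)); rewrite -iM !mulg1.
  move: cN; rewrite -iN => -[z _ zc]; rewrite -{}zc in c1 c2 cC.
  exists z.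
    rewrite center_groupE => g; apply: i_inj; rewrite !iM.
    by apply: cC; rewrite -iN; exists g.
  split=> // [|[|[|//]] // _].
    by apply: i_inj; rewrite expg2 iM c2 i1.
  by move=> z1; apply: c1; rewrite -i1 -z1.
tfae=> //.
- by move=> /ext3[Q [i [? ? ? _ _]]]; exists Q, i.
- by move=> /ext1/ext3.
- by move=> [Q [i [? ? ? _ _]]]; apply: ext1; exists Q, i.
Qed.
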